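(* Let $\Omega\subset\mathbb{R}^n$ be a bounded domain. Fix a base point $x_0\in\Omega$, and let $\phi:(0,\infty)\to(0,\infty)$ be a strictly increasing function with $\phi(t)\to\infty$ as $t\to\infty$ such that $$\int_0^\infty\frac{dt}{\phi^{-1}(t)}<\infty.$$ If $\Omega$ satisfies the growth condition $$k_\Omega(x_0,x)\le\phi\left(\frac{\delta_\Omega(x_0)}{\delta_\Omega(x)}\right)\quad\text{for all }x\in\Omega,$$ then $\Omega$ is a QH-visibility domain.
   Context: Here $\phi^{-1}$ denotes the inverse function of the strictly increasing function $\phi$. For a domain $\Omega\subsetneq\mathbb{R}^n$, $\partial_{Euc}\Omega$ is its Euclidean boundary and $\delta_\Omega(x)=d_{Euc}(x,\partial_{Euc}\Omega)$ is the Euclidean distance from $x$ to it. The quasihyperbolic length of a rectifiable curve $\gamma$ in $\Omega$ is $l_k(\gamma)=\int_\gamma\frac{|dx|}{\delta_\Omega(x)}$, and the quasihyperbolic metric is $k_\Omega(x,y)=\inf_\gamma l_k(\gamma)$, the infimum over rectifiable curves $\gamma$ in $\Omega$ joining $x$ and $y$. A quasihyperbolic geodesic is a rectifiable curve $\gamma$ in $\Omega$ such that $k_\Omega(x,y)=l_k(\gamma|_{[x,y]})$ for each pair of points $x,y\in\gamma$, where $\gamma|_{[x,y]}$ is the part of $\gamma$ between $x$ and $y$. A bounded domain $\Omega\subset\mathbb{R}^n$ is a QH-visibility domain if for every pair $p,q\in\partial_{Euc}\Omega$, $p\neq q$, there exist neighborhoods $U$ of $p$ and $V$ of $q$ with $\overline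 U\cap\overline V=\emptyset$ and a compact set $K\subset\Omega$ such that every quasihyperbolic geodesic $\gamma:[0,T]\to\Omega$ with $\gamma(0)\in U$ and $\gamma(T)\in V$ satisfies $\gamma([0,T])\cap K\neq\emptyset$. *)

(* Defs.v *)
From mathcomp Require Import all_boot all_order all_algebra.
From mathcomp Require Import all_classical all_reals all_analysis.

Set Implicit Arguments.
Unset Strict Implicit.
Unset Printing Implicit Defensive.

Import Order.TTheory GRing.Theory Num.Theory.
Import numFieldNormedType.Exports.

Local Open Scope classical_set_scope.
Local Open Scope ring_scope.

(* The canonical norm of 'rV[R]_n in the library is the sup norm. It is used
   here only through its topology and its bounded sets, which are the Euclidean
   ones; every metric quantity is computed with the Euclidean norm [enorm]. *)
Definition enorm (R : realType) (n : nat) (x : 'rV[R]_n) : R :=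
  Num.sqrt (\sum_(i < n) x ord0 i ^+ 2).

Definition euc_boundary (R : realType) (n : nat) (Om : set 'rV[R]_n) :
    set 'rV[R]_n :=
  closure Om `\` interior Om.

Definition is_domain (R : realType) (n : nat) (Om : set 'rV[R]_n) : Prop :=
  [/\ Om !=set0, open Om & connected Om].

Definition bounded_domain (R : realType) (n : nat) (Om : set 'rV[R]_n) : Prop :=
  is_domain Om /\ bounded_set Om.

Definition delta (R : realType) (n : nat) (Om : set 'rV[R]_n) (x : 'rV[R]_n) :
    R :=
  inf [set enorm (x - p) | p in euc_boundary Om].

(* As in [itv_partition], the partition a = t_0 < t_1 < ... < t_m = b is given
   by the list [:: t_1; ...; t_m]. *)
Definition polygonal_length (R : realType) (n : nat) (gam : R -> 'rV[R]_n)
    (a b : R) (s : seq R) : R :=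
  \sum_(0 <= i < size s)
     enorm (gam (nth b (a :: s) i.+1) - gam (nth b (a :: s) i)).

Definition curve_length (R : realType) (n : nat) (gam : R -> 'rV[R]_n)
    (a b : R) : \bar R :=
  ereal_sup [set (polygonal_length gam a b s)%:E | s in itv_partition a b].

Definition rectifiable_curve_in (R : realType) (n : nat) (Om : set 'rV[R]_n)
    (gam : R -> 'rV[R]_n) (a b : R) : Prop :=
  [/\ a <= b, {within `[a, b], continuous gam}, gam @` `[a, b] `<=` Om &
      (curve_length gam a b < +oo)%E].

(* The point of the curve at arc length s from gam a: the first parameter t at
   which gam|[a, t] has length at least s is picked. *)
Definition arclength_param (R : realType) (n : nat) (gam : R -> 'rV[R]_n)
    (a b : R) (s : R) : 'rV[R]_n :=
  gam (inf [set t | t \in `[a, b] /\ (s%:E <= curve_length gam a t)%E]).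

(* The line integral of 1 / delta along a rectifiable curve, i.e. the integral
   over [0, length] of 1 / delta along the arc-length parametrization. *)
Definition qh_length (R : realType) (n : nat) (Om : set 'rV[R]_n)
    (gam : R -> 'rV[R]_n) (a b : R) : \bar R :=
  (\int[@lebesgue_measure R]_(s in [set s : R | (0 <= s)%R /\
                                   (s%:E <= curve_length gam a b)%E])
     ((delta Om (arclength_param gam a b s))^-1)%:E)%E.

Definition qh_dist (R : realType) (n : nat) (Om : set 'rV[R]_n)
    (x y : 'rV[R]_n) : \bar R :=
  ereal_inf [set l | exists (gam : R -> 'rV[R]_n) (a b : R),
    [/\ rectifiable_curve_in Om gam a b, gam a = x, gam b = y &
        l = qh_length Om gam a b]].

Definition qh_geodesic (R : realType) (n : nat) (Om : set 'rV[R]_n)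
    (gam : R -> 'rV[R]_n) (T : R) : Prop :=
  rectifiable_curve_in Om gam 0 T /\
  forall s t : R, 0 <= s -> s <= t -> t <= T ->
    qh_dist Om (gam s) (gam t) = qh_length Om gam s t.

Definition qh_visibility_domain (R : realType) (n : nat) (Om : set 'rV[R]_n) :
    Prop :=
  bounded_domain Om /\
  forall p q : 'rV[R]_n, euc_boundary Om p -> euc_boundary Om q -> p <> q ->
    exists U V K : set 'rV[R]_n,
      [/\ nbhs p U, nbhs q V & closure U `&` closure V = set0] /\
      [/\ compact K, K `<=` Om &
          forall (gam : R -> 'rV[R]_n) (T : R), qh_geodesic Om gam T ->
            U (gam 0) -> V (gam T) -> gam @` `[0, T] `&` K !=set0].

(* The inverse of a strictly increasing function phi on (0, +oo), extended to
   the values omitted by phi, if any, as its generalized inverse (no continuity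
   of phi is assumed). It is the inverse function when phi is a bijection of
   (0, +oo), see [ginvK]. The value is 0 below the range of phi; as 0^-1 = +oo
   in \bar R, such values make the integral of 1 / phi^-1 infinite. *)
Definition ginv (R : realType) (phi : R -> R) (t : R) : \bar R :=
  ereal_inf [set s%:E | s in [set s : R | 0 < s /\ t <= phi s]].

Lemma ginvK (R : realType) (phi : R -> R) (s : R) :
  (forall r t : R, 0 < r -> r < t -> phi r < phi t) -> 0 < s ->
  ginv phi (phi s) = s%:E.
Proof.
move=> phiS s0; apply/eqP; rewrite eq_le; apply/andP; split.
  by apply: ereal_inf_lbound; exists s.
apply: le_ereal_inf_tmp => _ [r [r0 sr] <-]; rewrite lee_fin leNgt.
by apply/negP => rs; have := phiS r s r0 rs; rewrite ltNge sr.
Qed.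

(* Main.v *)
Require Import Defs.
From mathcomp Require Import all_boot all_order all_algebra.
From mathcomp Require Import all_classical all_reals all_analysis.
From mathcomp Require Import measurable_realfun.
From mathcomp Require Import lra ring zify.

Set Implicit Arguments.
Unset Strict Implicit.
Unset Printing Implicit Defensive.

Import Order.TTheory GRing.Theory Num.Theory.
Import numFieldNormedType.Exports.

Local Open Scope classical_set_scope.
Local Open Scope ring_scope.

(** The idea is to bound the Euclidean length of a quasihyperbolic geodesic that
    stays where delta is small. Let sig be its arc length parametrization, write
    k for the metric, g u = k (x0, sig u), and let tau be the quasihyperbolic
    arc length measured from a point u0 where g is almost minimal. As sig is a
    geodesic, |tau u| = k (sig u0, sig u) <= g u0 + g u, which is at most 3 g u;
    so g grows linearly with |tau|. The growth condition says that
    delta (sig u) <= delta x0 / phi^-1 (g u). Since du = delta d tau, the length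
    of the geodesic is at most a constant times the integral of
    1 / phi^-1 (max (m, |tau| / 3)), where m is a lower bound for g. Where delta
    is small, g is large, because k (x0, x) >= ln (delta x0 / delta x)
    ([ln_le_qh_dist]); and as 1 / phi^-1 is integrable, that integral tends to 0
    as m tends to infinity. A geodesic joining neighborhoods of two distinct
    boundary points has length bounded below, so it cannot stay in the part
    delta < eps for eps small: it meets the compact set delta >= eps.

    Two points need work. The first is that k is a metric: curves are replaced
    by unit speed paths ([unit_speed_path_arclength],
    [unit_speed_path_qh_dist]), for which the quasihyperbolic length is an
    integral of 1 / delta over an interval ([qh_cost]), compatible with
    restriction, reversal and concatenation. This gives the triangle inequality
    and the fact that subpaths of geodesics are geodesics
    ([geodesic_path_of_endpoints]). The second is the change of variables
    du = delta d tau against a function of tau that is only monotone; it is done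
    on the pieces where |tau| grows by 3 ([length_le_discrete_sum]), which
    replaces the integral by a series whose smallness is
    [truncated_sum_small], and whose convergence is [decay_rate_summable]. The
    two halves of the geodesic are treated in [geodesic_ray_length] and put
    together in [geodesic_length]. *)

(** * The Euclidean norm *)

Lemma enorm_ge0 (R : realType) (n : nat) (x : 'rV[R]_n) : 0 <= enorm x.
Proof. exact: sqrtr_ge0. Qed.

Lemma sqr_enorm (R : realType) (n : nat) (x : 'rV[R]_n) :
  enorm x ^+ 2 = \sum_(i < n) x ord0 i ^+ 2.
Proof. by rewrite sqr_sqrtr// sumr_ge0// => i _; exact: sqr_ge0. Qed.

Lemma enorm0 (R : realType) (n : nat) : enorm (0 : 'rV[R]_n) = 0.
Proof.
by rewrite /enorm big1 ?sqrtr0// => i _; rewrite mxE expr0n.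
Qed.

Lemma enormN (R : realType) (n : nat) (x : 'rV[R]_n) : enorm (- x) = enorm x.
Proof.
by congr Num.sqrt; apply: eq_bigr => i _; rewrite mxE sqrrN.
Qed.

Lemma enorm_distC (R : realType) (n : nat) (x y : 'rV[R]_n) :
  enorm (x - y) = enorm (y - x).
Proof. by rewrite -enormN opprB. Qed.

Lemma ler_norm_enorm (R : realType) (n : nat) (x : 'rV[R]_n) :
  `|x| <= enorm x.
Proof.
rewrite [leLHS]/Num.norm/= mx_normrE; apply: bigmax_le; first exact: enorm_ge0.
move=> [i j] _ /=; rewrite (ord1 i) -sqrtr_sqr; apply: ler_wsqrtr.
rewrite (bigD1 j)//= lerDl sumr_ge0// => k _; exact: sqr_ge0.
Qed.

Lemma ler_enorm_norm (R : realType) (n : nat) (x : 'rV[R]_n) :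
  enorm x <= n.+1%:R * `|x|.
Proof.
have cx i : `|x ord0 i| <= `|x|.
  rewrite [leRHS]/Num.norm/= mx_normrE.
  exact: (@le_bigmax _ _ _ 0
    (fun ij : 'I_1 * 'I_n => `|x ij.1 ij.2|) (ord0, i)).
rewrite -(@ler_pXn2r _ 2)// ?nnegrE ?enorm_ge0 ?mulr_ge0// sqr_enorm exprMn.
apply: (@le_trans _ _ (\sum_(i < n) `|x| ^+ 2)).
  apply: ler_sum => i _.
  by rewrite -[leLHS]real_normK ?num_real// lerXn2r ?nnegrE.
rewrite sumr_const card_ord -[leLHS]mulr_natl ler_wpM2r ?sqr_ge0//.
by rewrite -natrX ler_nat; lia.
Qed.

Lemma enorm_eq0 (R : realType) (n : nat) (x : 'rV[R]_n) :
  enorm x = 0 -> x = 0.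
Proof.
move=> x0; apply/eqP; rewrite -normr_eq0 eq_le normr_ge0 andbT -x0.
exact: ler_norm_enorm.
Qed.

Lemma ler_enormD (R : realType) (n : nat) (x y : 'rV[R]_n) :
  enorm (x + y) <= enorm x + enorm y.
Proof.
set a := enorm x; set b := enorm y.
have a0 : 0 <= a := enorm_ge0 x; have b0 : 0 <= b := enorm_ge0 y.
set p := \sum_(i < n) x ord0 i * y ord0 i.
have E (s t : R) : enorm (s *: x + t *: y) ^+ 2 =
    s ^+ 2 * a ^+ 2 + t ^+ 2 * b ^+ 2 + 2 * s * t * p.
  rewrite !sqr_enorm !mulr_sumr -!big_split/=.
  by apply: eq_bigr => i _; rewrite !mxE; ring.
(* Cauchy-Schwarz, from the squared norm of b x - a y *)
have pab : p <= a * b.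
  have : 0 <= a * b by exact: mulr_ge0.
  rewrite le_eqVlt => /predU1P[/esym/eqP|ab].
    rewrite mulf_eq0 => /orP[] /eqP /enorm_eq0 z0.
      by rewrite /p big1 ?mulr_ge0// => i _; rewrite z0 mxE mul0r.
    by rewrite /p big1 ?mulr_ge0// => i _; rewrite z0 mxE mulr0.
  have := sqr_ge0 (enorm (b *: x + (- a) *: y)); rewrite E => h.
  rewrite -(ler_pM2l ab); nra.
rewrite -(@ler_pXn2r _ 2)// ?nnegrE ?enorm_ge0 ?addr_ge0//.
have := E 1 1; rewrite !scale1r => ->; nra.
Qed.

Lemma ler_edistD (R : realType) (n : nat) (y x z : 'rV[R]_n) :
  enorm (x - z) <= enorm (x - y) + enorm (y - z).
Proof. by rewrite -{1}(subrK y x) -addrA; exact: ler_enormD. Qed.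

Lemma nbhs_enorm_ball (R : realType) (n : nat) (x : 'rV[R]_n) (r : R) :
  0 < r -> nbhs x [set y | enorm (x - y) < r].
Proof.
move=> r0; apply/nbhs_ballP; exists (r / n.+1%:R); first by rewrite /= divr_gt0.
rewrite mx_norm_ball => y /=; rewrite ltr_pdivlMr// mulrC => xy.
exact: le_lt_trans (ler_enorm_norm _) xy.
Qed.

Lemma nbhs_enormP (R : realType) (n : nat) (x : 'rV[R]_n) (A : set 'rV[R]_n) :
  nbhs x A -> exists2 r : R, 0 < r & forall y, enorm (x - y) < r -> A y.
Proof.
move=> /nbhs_ballP[r/= r0 rA]; exists r => // y xy; apply: rA.
by rewrite mx_norm_ball /=; exact: le_lt_trans (ler_norm_enorm _) xy.
Qed.

Lemma within_continuous_enorm (R : realType) (n : nat) (gam : R -> 'rV[R]_n)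
    (a b t e : R) :
  {within `[a, b], continuous gam} -> t \in `[a, b] -> 0 < e ->
  exists2 d : R, 0 < d &
    forall u, u \in `[a, b] -> `|t - u| < d -> enorm (gam t - gam u) < e.
Proof.
move=> cg tab e0; have := cg t.
rewrite /continuous_at /nbhs/= /nbhs_subspace /= mem_set//.
move=> /(_ _ (nbhs_enorm_ball (gam t) e0)) /nbhs_ballP[d/= d0 H].
by exists d => // u uab tu; apply: H.
Qed.

(** * Length of curves *)

Lemma polygonal_length_rcons (R : realType) (n : nat) (gam : R -> 'rV[R]_n)
    (a b c : R) (s : seq R) : itv_partition a b s ->
  polygonal_length gam a c (rcons s c) =
  polygonal_length gam a b s + enorm (gam c - gam b).
Proof.
move=> abs; rewrite /polygonal_length size_rcons big_nat_recr//=.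
have E i : (i <= size s)%N -> nth c (a :: rcons s c) i = nth b (a :: s) i.
  move=> ile; rewrite -rcons_cons nth_rcons/= ltnS ile.
  exact: set_nth_default.
congr (_ + enorm (gam _ - gam _)).
- apply: eq_big_nat => i /andP[_ ilt].
  by have := E _ ilt; have := E _ (ltnW ilt); rewrite /= => -> ->.
- by rewrite nth_rcons ltnn eqxx.
- by have := E _ (leqnn _); rewrite (itv_partition_nth_size b abs).
Qed.

(** Removing the repetitions from a nondecreasing subdivision gives a strictly
    increasing one with the same polygonal length. *)
Lemma polygonal_length_monotone (R : realType) (n : nat) (gam : R -> 'rV[R]_n)
    (t : nat -> R) (m : nat) : (forall i, (i < m)%N -> t i <= t i.+1) ->
  exists2 s, itv_partition (t 0%N) (t m) s &
    polygonal_length gam (t 0%N) (t m) s =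
    \sum_(0 <= i < m) enorm (gam (t i.+1) - gam (t i)).
Proof.
elim: m => [|m IH] tm.
  by exists [::]; rewrite // /polygonal_length !big_nil.
have [i im|s s_part s_len] := IH; first exact/tm/ltnW.
rewrite big_nat_recr//= -s_len; move: (tm m (ltnSn m)).
rewrite le_eqVlt => /predU1P[<-|lt_t].
  by exists s; rewrite // subrr enorm0 addr0.
exists (rcons s (t m.+1)); last exact: polygonal_length_rcons.
by rewrite -cats1; apply: itv_partition_cat s_part _; exact: itv_partition1.
Qed.

Lemma subdivision_monotone (R : realType) (t : nat -> R) (m : nat) :
  (forall i, (i < m)%N -> t i <= t i.+1) ->
  forall i j, (i <= j <= m)%N -> t i <= t j.
Proof.
move=> tm i; elim=> [|j IH]; first by rewrite leqn0 => /andP[/eqP->].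
move=> /andP[]; rewrite leq_eqVlt => /predU1P[->//|ij jm].
by apply: le_trans (tm _ jm); apply: IH; rewrite -ltnS ij ltnW.
Qed.

(** Lower bounds on a length can thus be read off any nondecreasing subdivision,
    possibly with repetitions and not reaching the endpoints; this flexibility
    makes additivity and invariance under reparametrization cheap. *)
Lemma le_curve_length (R : realType) (n : nat) (gam : R -> 'rV[R]_n)
    (a b : R) (t : nat -> R) (m : nat) :
  (forall i, (i < m)%N -> t i <= t i.+1) -> a <= t 0%N -> t m <= b ->
  ((\sum_(0 <= i < m) enorm (gam (t i.+1) - gam (t i)))%:E
     <= curve_length gam a b)%E.
Proof.
move=> tm at0 tmb.
(* the subdivision is completed by the two endpoints *)
pose u i := if i is j.+1 then (if (j <= m)%N then t j else b) else a.
have um i : (i < m.+2)%N -> u i <= u i.+1.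
  case: i => [_//=|i]; rewrite !ltnS /= => im; rewrite im.
  case: ifPn => [|im']; first exact: tm.
  by have -> : i = m by lia.
have [s s_part s_len] := polygonal_length_monotone gam um.
have ub : u m.+2 = b by rewrite /u /= ltnn.
rewrite ub /= in s_part s_len.
apply: (@le_trans _ _ (polygonal_length gam a b s)%:E); last first.
  by apply: ereal_sup_ubound; exists s.
rewrite lee_fin s_len big_nat_recl// big_nat_recr//=.
rewrite -[leLHS]add0r lerD ?enorm_ge0// -[leLHS]addr0 lerD ?enorm_ge0//.
by rewrite le_eqVlt; apply/orP; left; apply/eqP/eq_big_nat => i /andP[_ im] /=;
  rewrite im ltnW.
Qed.

Lemma curve_length_le (R : realType) (n : nat) (gam : R -> 'rV[R]_n)
    (a b : R) (l : \bar R) :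
  (forall (t : nat -> R) (m : nat), (forall i, (i < m)%N -> t i <= t i.+1) ->
     t 0%N = a -> t m = b ->
     ((\sum_(0 <= i < m) enorm (gam (t i.+1) - gam (t i)))%:E <= l)%E) ->
  (curve_length gam a b <= l)%E.
Proof.
move=> H; apply: ge_ereal_sup => _ [s abs <-].
apply: H => [i ils||] //; last exact: itv_partition_nth_size.
by have := @nondecreasing_fun_itv_partition _ _ a b id s _ abs i ils; apply.
Qed.

Lemma enorm_le_curve_length (R : realType) (n : nat) (gam : R -> 'rV[R]_n)
    (a s t b : R) : a <= s -> s <= t -> t <= b ->
  ((enorm (gam t - gam s))%:E <= curve_length gam a b)%E.
Proof.
move=> as_ st tb.
have := @le_curve_length _ _ gam a b (fun i => if i is 0%N then s else t) 1.
by rewrite big_nat1; apply => // -[].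
Qed.

Lemma curve_length_ge0 (R : realType) (n : nat) (gam : R -> 'rV[R]_n)
    (a b : R) : a <= b -> (0 <= curve_length gam a b)%E.
Proof.
by move=> ab; apply: le_trans (enorm_le_curve_length gam _ ab _) => //;
  rewrite lee_fin enorm_ge0.
Qed.

Lemma curve_length_superadd (R : realType) (n : nat) (gam : R -> 'rV[R]_n)
    (a b c : R) : a <= b -> b <= c ->
  (curve_length gam a b + curve_length gam b c <= curve_length gam a c)%E.
Proof.
move=> ab bc.
have H (t : nat -> R) m : (forall i, (i < m)%N -> t i <= t i.+1) ->
    t 0%N = a -> t m = b ->
    ((\sum_(0 <= i < m) enorm (gam (t i.+1) - gam (t i)))%:E +
       curve_length gam b c <= curve_length gam a c)%E.
  move=> tm t0 tmb; rewrite addeC -leeBrDr//.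
  apply: curve_length_le => u k uk u0 ukc.
  rewrite leeBrDr// -EFinD addrC.
  pose v i := if (i <= m)%N then t i else u (i - m)%N.
  have vr i : v (i + m)%N = u i.
    rewrite /v addnK; case: i => [|i]; first by rewrite add0n leqnn tmb u0.
    by rewrite ifF//; lia.
  have vl i : (i <= m)%N -> v i = t i by rewrite /v => ->.
  have := @le_curve_length _ _ gam a c v (k + m).
  rewrite vr vl// t0 ukc (@big_cat_nat _ _ _ m) ?leq_addl//=.
  rewrite (_ : \sum_(m <= i < k + m) _ = \sum_(0 <= i < k)
    enorm (gam (v (i + m).+1) - gam (v (i + m)%N))); last first.
    by rewrite -{1}[m]add0n big_addn addnK.
  rewrite (eq_big_nat _ _
    (F2 := fun i => enorm (gam (t i.+1) - gam (t i)))); last first.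
    by move=> i /andP[_ im]; rewrite !vl// ltnW.
  rewrite [X in _ + X](eq_big_nat _ _
    (F2 := fun i => enorm (gam (u i.+1) - gam (u i)))); last first.
    by move=> i _; rewrite -addSn !vr.
  apply=> // i ikm; have [im|mi] := ltnP i m; first by rewrite !vl ?tm// ltnW.
  by rewrite -(subnK mi) -addSn !vr; apply: uk; lia.
have [bcy|bcy] := eqVneq (curve_length gam b c) +oo%E.
  have := H (fun i => if i is 0%N then a else b) 1%N.
  rewrite bcy addey// => /(_ _ erefl erefl) Hy.
  by rewrite (le_trans _ (Hy _)) ?leey// => -[].
have bcf : curve_length gam b c \is a fin_num.
  by rewrite ge0_fin_numE ?curve_length_ge0// lt_neqAle bcy leey.
rewrite -leeBrDr//; apply: curve_length_le => t m tm t0 tmb.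
by rewrite leeBrDr//; exact: H.
Qed.

(** A subdivision t of [a, c] splits at b into the truncations min(t, b) and
    max(t, b); only the step straddling b needs the triangle inequality. *)
Lemma curve_length_subadd (R : realType) (n : nat) (gam : R -> 'rV[R]_n)
    (a b c : R) : a <= b -> b <= c ->
  (curve_length gam a c <= curve_length gam a b + curve_length gam b c)%E.
Proof.
move=> ab bc; apply: curve_length_le => t m tm t0 tmc.
have t_le := subdivision_monotone tm.
pose v i := Num.min (t i) b; pose w i := Num.max (t i) b.
have vm i : (i < m)%N -> v i <= v i.+1.
  by move=> /tm ti; rewrite /v le_min !ge_min ti lexx orbT.
have wm i : (i < m)%N -> w i <= w i.+1.
  by move=> /tm ti; rewrite /w ge_max !le_max ti lexx orbT.
have := @le_curve_length _ _ gam a b v m vm.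
rewrite /v t0 le_min lexx ab ge_min lexx orbT => /(_ isT isT) Hv.
have := @le_curve_length _ _ gam b c w m wm.
rewrite /w tmc ge_max lexx bc le_max lexx orbT => /(_ isT isT) Hw.
apply: le_trans (leeD Hv Hw); rewrite -EFinD lee_fin -big_split/=.
rewrite big_nat_cond [leRHS]big_nat_cond; apply: ler_sum => i.
rewrite andbT => /andP[_ /tm ti].
have [tib|bti] := leP (t i.+1) b.
  by rewrite !(min_idPl _) ?(le_trans ti)//; rewrite lerDl enorm_ge0.
have [tib|/ltW btti] := leP (t i) b.
  by rewrite addrC; exact: ler_edistD.
by rewrite subrr enorm0 add0r.
Qed.

(** * Unit speed paths *)

(** The change of parameter h is only nondecreasing, since it may stop, as
    the arc length function of a curve does where the curve stops. *)
Lemma curve_length_reparam (R : realType) (n : nat) (gam gam' : R -> 'rV[R]_n)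
    (h : R -> R) (a b a' b' : R) :
  {in `[a, b] &, {homo h : s t / s <= t}} -> a' <= h a -> h b <= b' ->
  {in `[a, b], forall t, gam t = gam' (h t)} ->
  (curve_length gam a b <= curve_length gam' a' b')%E.
Proof.
move=> hm ha hb gamE; apply: curve_length_le => t m tm t0 tmb.
have tab i : (i <= m)%N -> t i \in `[a, b].
  move=> im; rewrite in_itv/= -t0 -tmb.
  by rewrite !(subdivision_monotone tm) ?leqnn ?leq0n//= im.
under eq_big_nat => i /andP[_ im] do rewrite !gamE ?tab ?(ltnW im)//.
apply: (le_curve_length gam' (t := h \o t)) => [i im||] /=.
- by apply: hm (tm _ im); rewrite tab// ltnW.
- by rewrite t0.
- by rewrite tmb.
Qed.

Lemma curve_length_rev (R : realType) (n : nat) (gam : R -> 'rV[R]_n)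
    (a b c : R) :
  (curve_length gam a b <=
   curve_length (fun s => gam (c - s)%R) (c - b) (c - a))%E.
Proof.
apply: curve_length_le => t m tm t0 tmb.
have := @le_curve_length _ _ (fun s => gam (c - s)) (c - b) (c - a)
  (fun i => c - t (m - i)%N) m.
rewrite subn0 subnn t0 tmb => /(_ _ (lexx _) (lexx _)) H.
rewrite big_nat_rev/= add0n; apply: le_trans (H _); last first.
  move=> i im; rewrite lerB// subnS; have := @tm (m - i).-1.
  by rewrite prednK ?subn_gt0//; apply; lia.
rewrite lee_fin le_eqVlt; apply/orP; left.
apply/eqP/eq_big_nat => i /andP[_ im].
by rewrite !subKr enorm_distC subnSK.
Qed.

Definition lipschitz1 (R : realType) (n : nat) (sig : R -> 'rV[R]_n) :=
  forall s t : R, enorm (sig s - sig t) <= `|s - t|.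

Lemma lipschitz1_curve_length (R : realType) (n : nat) (sig : R -> 'rV[R]_n)
    (u v : R) : lipschitz1 sig -> (curve_length sig u v <= (v - u)%:E)%E.
Proof.
move=> lip; apply: curve_length_le => t m tm <- <-; rewrite lee_fin.
rewrite -telescope_sumr//; rewrite big_nat_cond [leRHS]big_nat_cond.
apply: ler_sum => i; rewrite andbT => /andP[_ /tm ti].
by rewrite (le_trans (lip _ _))// ger0_norm ?subr_ge0.
Qed.

(** A path in Om parametrized by arc length: together with the Lipschitz
    condition, the bound on the length forces unit speed. Taking the Lipschitz
    condition on the whole line makes reversals and restrictions immediate. *)
Definition unit_speed_path (R : realType) (n : nat) (Om : set 'rV[R]_n)
    (sig : R -> 'rV[R]_n) (L : R) :=
  [/\ 0 <= L, lipschitz1 sig, (L%:E <= curve_length sig 0 L)%E &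
      forall s, 0 <= s <= L -> Om (sig s)].

(** The Lipschitz bounds on the three pieces of [0, L] add up to L, so none of
    them can be strict. *)
Lemma unit_speed_curve_length (R : realType) (n : nat) (Om : set 'rV[R]_n)
    (sig : R -> 'rV[R]_n) (L u v : R) : unit_speed_path Om sig L ->
  0 <= u -> u <= v -> v <= L -> curve_length sig u v = (v - u)%:E.
Proof.
move=> [L0 lip lenL _] u0 uv vL; apply/eqP.
rewrite eq_le lipschitz1_curve_length//=.
have h1 := curve_length_subadd sig u0 (le_trans uv vL).
have h2 := curve_length_subadd sig uv vL.
have h3 := lipschitz1_curve_length 0 u lip.
have h4 := lipschitz1_curve_length v L lip.
have h5 := lipschitz1_curve_length u v lip.
have h6 := curve_length_ge0 sig uv.
have : (L%:E <= (u - 0)%:E + (curve_length sig u v + (L - v)%:E))%E.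
  apply: (le_trans lenL); apply: (le_trans h1); apply: leeD => //.
  by apply: (le_trans h2); apply: leeD.
move: h6 h5; case: (curve_length sig u v) => // r _ _.
by rewrite -!EFinD !lee_fin; lra.
Qed.

Lemma unit_speed_path_rev (R : realType) (n : nat) (Om : set 'rV[R]_n)
    (sig : R -> 'rV[R]_n) (L : R) : unit_speed_path Om sig L ->
  unit_speed_path Om (fun s => sig (L - s)) L.
Proof.
move=> [L0 lip lenL sOm]; split=> //.
- move=> s t; rewrite (le_trans (lip _ _))//.
  by rewrite distrC (_ : L - t - (L - s) = s - t)//; ring.
- apply: (le_trans lenL); have := curve_length_rev sig 0 L L.
  by rewrite subrr subr0.
- by move=> s sL; apply: sOm; lra.
Qed.

Lemma unit_speed_path_sub (R : realType) (n : nat) (Om : set 'rV[R]_n)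
    (sig : R -> 'rV[R]_n) (L u v : R) : unit_speed_path Om sig L ->
  0 <= u -> u <= v -> v <= L ->
  unit_speed_path Om (fun s => sig (s + u)) (v - u).
Proof.
move=> sigP u0 uv vL; have uvE := unit_speed_curve_length sigP u0 uv vL.
case: sigP => [L0 lip lenL sOm]; split=> //.
- by rewrite subr_ge0.
- move=> s t; rewrite (le_trans (lip _ _))//.
  by rewrite (_ : s + u - (t + u) = s - t)//; ring.
- rewrite -uvE; apply: (curve_length_reparam (h := fun s => s - u)).
  + by move=> s t _ _ st; rewrite lerB.
  + by rewrite subrr.
  + by [].
  + by move=> t _; rewrite subrK.
- by move=> s suv; apply: sOm; lra.
Qed.

Definition path_cat (R : realType) (n : nat) (sig1 sig2 : R -> 'rV[R]_n)
  (L : R) : R -> 'rV[R]_n := fun s => if s <= L then sig1 s else sig2 (s - L).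

Lemma path_catl (R : realType) (n : nat) (sig1 sig2 : R -> 'rV[R]_n)
    (L s : R) : s <= L -> path_cat sig1 sig2 L s = sig1 s.
Proof. by rewrite /path_cat => ->. Qed.

Lemma path_catr (R : realType) (n : nat) (sig1 sig2 : R -> 'rV[R]_n)
    (L s : R) : sig1 L = sig2 0 -> 0 <= s ->
  path_cat sig1 sig2 L (s + L) = sig2 s.
Proof.
move=> glue; rewrite le_eqVlt => /predU1P[<-|s0].
  by rewrite path_catl ?add0r.
by rewrite /path_cat addrK gerDr leNgt s0.
Qed.

Lemma unit_speed_path_cat (R : realType) (n : nat) (Om : set 'rV[R]_n)
    (sig1 sig2 : R -> 'rV[R]_n) (L1 L2 : R) :
  unit_speed_path Om sig1 L1 -> unit_speed_path Om sig2 L2 ->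
  sig1 L1 = sig2 0 ->
  unit_speed_path Om (path_cat sig1 sig2 L1) (L1 + L2).
Proof.
move=> [L10 lip1 len1 Om1] [L20 lip2 len2 Om2] glue; split.
- exact: addr_ge0.
- have lip_le s t : s <= t ->
      enorm (path_cat sig1 sig2 L1 s - path_cat sig1 sig2 L1 t) <= `|s - t|.
    move=> st; rewrite /path_cat.
    have [tL|Lt] := leP t L1; first by rewrite (le_trans st tL).
    have [sL|Ls] := leP s L1; last first.
      apply: (le_trans (lip2 _ _)).
      by rewrite (_ : s - L1 - (t - L1) = s - t)//; ring.
    apply: (le_trans (ler_edistD (sig1 L1) _ _)).
    have h1 := lip1 s L1; have h2 := lip2 0 (t - L1).
    rewrite -glue in h2; apply: (le_trans (lerD h1 h2)).
    by rewrite !ler0_norm; lra.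
  move=> s t; have [|/ltW ts] := leP s t; first exact: lip_le.
  by rewrite enorm_distC distrC; exact: lip_le.
- have L12 : L1 <= L1 + L2 by rewrite lerDl.
  apply: le_trans (curve_length_superadd _ L10 L12); rewrite EFinD.
  apply: leeD.
    apply: (le_trans len1); apply: (curve_length_reparam (h := id)) => // s.
    by rewrite in_itv/= => /andP[_ sL]; rewrite path_catl.
  apply: (le_trans len2); apply: (curve_length_reparam (h := fun s => s + L1)).
  + by move=> s t _ _ st; rewrite lerD2r.
  + by rewrite add0r.
  + by rewrite addrC.
  + by move=> s; rewrite in_itv/= => /andP[s0 _]; rewrite path_catr.
- move=> s sL; rewrite /path_cat; have [s1|s1] := leP s L1.
    by apply: Om1; lra.
  by apply: Om2; lra.
Qed.

(** * Arc length parametrization *)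

Lemma curve_length_dist (R : realType) (n : nat) (gam : R -> 'rV[R]_n)
    (a t u : R) : a <= t -> t <= u ->
  ((enorm (gam u - gam t))%:E + curve_length gam a t <= curve_length gam a u)%E.
Proof.
move=> at_ tu; apply: le_trans (curve_length_superadd gam at_ tu).
by rewrite addeC leeD2l// enorm_le_curve_length.
Qed.

Lemma curve_length_homo (R : realType) (n : nat) (gam : R -> 'rV[R]_n)
    (a t u : R) : a <= t -> t <= u ->
  (curve_length gam a t <= curve_length gam a u)%E.
Proof.
move=> at_ tu; apply: le_trans (curve_length_dist gam at_ tu).
by rewrite leeDr// lee_fin enorm_ge0.
Qed.

(** The parameter picked by [arclength_param]. *)
Definition arrival (R : realType) (n : nat) (gam : R -> 'rV[R]_n)
    (a b : R) (s : R) : R :=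
  inf [set t | t \in `[a, b] /\ (s%:E <= curve_length gam a t)%E].

Section arrival.
Variables (R : realType) (n : nat) (gam : R -> 'rV[R]_n) (a b : R).
Hypothesis ab : a <= b.
Hypothesis cont_gam : {within `[a, b], continuous gam}.

Let tau := arrival gam a b.
Let len := curve_length gam a.

Let has_inf_arrival s : (s%:E <= len b)%E ->
  has_inf [set t | t \in `[a, b] /\ (s%:E <= len t)%E].
Proof.
move=> sb; split; first by exists b; rewrite /= in_itv/= ab lexx.
by exists a => t [] /[!in_itv]/= /andP[].
Qed.

Lemma arrival_le s t : a <= t <= b -> (s%:E <= len t)%E -> tau s <= t.
Proof.
move=> tab st; apply: ge_inf; last by rewrite /= in_itv.
by exists a => u [] /[!in_itv]/= /andP[].
Qed.

Lemma arrival_itv s : (s%:E <= len b)%E -> a <= tau s <= b.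
Proof.
move=> sb; rewrite arrival_le ?ab ?lexx ?andbT//.
by apply: lb_le_inf (has_inf_arrival sb).1 _ => u [] /[!in_itv]/= /andP[].
Qed.

Lemma arrival_lt s t : (s%:E <= len b)%E -> tau s < t -> (s%:E <= len t)%E.
Proof.
move=> sb taut.
have [u [uab su] ut] := inf_adherent
  (etrans (subr_gt0 _ _) taut) (has_inf_arrival sb).
rewrite addrC subrK in ut; apply: (le_trans su).
move: uab; rewrite in_itv/= => /andP[au _].
by apply: curve_length_homo => //; exact: ltW.
Qed.

Let dist_arrival_right s e u :
  (s%:E <= len b)%E -> 0 < e -> tau s < u -> u <= b ->
  exists2 t, tau s < t <= u & enorm (gam (tau s) - gam t) < e.
Proof.
move=> sb e0 su ub; have /andP[ats tsb] := arrival_itv sb.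
have tsab : tau s \in `[a, b] by rewrite in_itv/= ats.
have [d d0 H] := within_continuous_enorm cont_gam tsab e0.
exists (Num.min (tau s + d / 2) u).
  by rewrite lt_min su ltrDl divr_gt0//= ge_min lexx orbT.
apply: H.
  rewrite in_itv/= le_min ge_min ub orbT (le_trans ats (ltW su)) !andbT.
  by rewrite (le_trans ats)// lerDl divr_ge0 ?ltW.
rewrite ler0_norm; last first.
  by rewrite subr_le0 le_min lerDl divr_ge0 ?(ltW su)//= ltW.
by rewrite opprB ltrBlDl gt_min ltrD2l ltr_pdivrMr// ltr_pMr// ltr1n.
Qed.

Let dist_arrival_left s e u :
  (s%:E <= len b)%E -> 0 < e -> a <= u -> u < tau s ->
  exists2 t, u <= t < tau s & enorm (gam (tau s) - gam t) < e.
Proof.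
move=> sb e0 au us; have /andP[ats tsb] := arrival_itv sb.
have tsab : tau s \in `[a, b] by rewrite in_itv/= ats.
have [d d0 H] := within_continuous_enorm cont_gam tsab e0.
exists (Num.max (tau s - d / 2) u).
  by rewrite gt_max us ltrBlDr ltrDl divr_gt0//= le_max lexx orbT.
apply: H.
  rewrite in_itv/= ge_max le_max au orbT (le_trans (ltW us) tsb) andbT/=.
  by rewrite (le_trans _ tsb)// lerBlDr lerDl divr_ge0 ?ltW.
rewrite ger0_norm; last first.
  by rewrite subr_ge0 ge_max (ltW us) andbT lerBlDr lerDl divr_ge0// ltW.
by rewrite ltrBlDr -ltrBlDl lt_max ltrD2l ltrN2 ltr_pdivrMr// ltr_pMr// ltr1n.
Qed.

(** To avoid proving that the length function is continuous, the increment is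
    estimated between parameters slightly after the first arrival time and
    slightly before the second one. *)
Lemma lipschitz_arrival s s' : s <= s' -> (s'%:E <= len b)%E ->
  enorm (gam (tau s) - gam (tau s')) <= s' - s.
Proof.
move=> ss' s'b.
have sb : (s%:E <= len b)%E by rewrite (le_trans _ s'b)// lee_fin.
have /andP[ats tsb] := arrival_itv sb; have /andP[ats' ts'b] := arrival_itv s'b.
have : tau s <= tau s'.
  apply: lb_le_inf (has_inf_arrival s'b).1 _ => u [] /[!in_itv]/= uab s'u.
  by apply: arrival_le => //; rewrite (le_trans _ s'u)// lee_fin.
rewrite le_eqVlt => /predU1P[->|lt_tau]; first by rewrite subrr enorm0 subr_ge0.
apply/ler_addgt0Pr => e e0; have e20 : 0 < e / 2 by rewrite divr_gt0.
pose mid := (tau s + tau s') / 2.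
have [smid mids'] : tau s < mid /\ mid < tau s' by rewrite /mid; split; lra.
have [t /andP[st tmid] dt] :=
  dist_arrival_right sb e20 smid (le_trans (ltW mids') ts'b).
have [u /andP[midu us'] du] :=
  dist_arrival_left s'b e20 (le_trans ats (ltW smid)) mids'.
have at_ := le_trans ats (ltW st); have tu := le_trans tmid midu.
have ub := le_trans (ltW us') ts'b.
have len_u : (len u <= s'%:E)%E.
  rewrite leNgt; apply/negP => /ltW /arrival_le.
  by rewrite (le_trans at_ tu) ub => /(_ isT); rewrite leNgt us'.
have : ((enorm (gam u - gam t))%:E + s%:E <= s'%:E)%E.
  apply: le_trans len_u; apply: le_trans (curve_length_dist gam at_ tu).
  by apply: leeD => //; exact: arrival_lt sb st.
rewrite -EFinD lee_fin => tu_le.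
apply: (le_trans (ler_edistD (gam t) _ _)).
have := ler_edistD (gam u) (gam t) (gam (tau s')).
rewrite [enorm (gam u - gam (tau s'))]enorm_distC.
by rewrite [enorm (gam t - gam u)]enorm_distC; lra.
Qed.

(** Between the first arrival at arc length s and any other parameter t with the
    same arc length, the curve does not move. *)
Lemma arrival_curve_length s t :
  (len b < +oo)%E -> a <= t <= b -> s%:E = len t ->
  gam (tau s) = gam t.
Proof.
move=> lenb /andP[at_ tb] st.
have sb : (s%:E <= len b)%E by rewrite st; exact: curve_length_homo.
have : tau s <= t by apply: arrival_le; rewrite ?at_ // st.
rewrite le_eqVlt => /predU1P[->//|lt_t].
apply/eqP; rewrite -subr_eq0; apply/eqP/enorm_eq0/eqP.
rewrite eq_le enorm_ge0 andbT; apply/ler_addgt0Pr => e e0; rewrite add0r.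
have [u /andP[su ut] du] := dist_arrival_right sb e0 lt_t tb.
have au : a <= u.
  by have /andP[h _] := arrival_itv sb; rewrite (le_trans h)// ltW.
have : ((enorm (gam t - gam u))%:E + s%:E <= s%:E)%E.
  rewrite {2}st; apply: le_trans (curve_length_dist gam au ut).
  by apply: leeD => //; exact: arrival_lt sb su.
rewrite -EFinD lee_fin gerDr => tu0.
by have := ler_edistD (gam u) (gam (tau s)) (gam t);
  rewrite [enorm (gam u - gam t)]enorm_distC; lra.
Qed.

End arrival.

Section arclength_reparametrization.
Variables (R : realType) (n : nat) (Om : set 'rV[R]_n).

(** The arc length parametrization runs at unit speed: it is 1-Lipschitz, and
    its length is at least that of the curve because the curve factors through
    it. It is frozen beyond the total length L, where the set of arrival times
    is empty. *)
Lemma unit_speed_path_arclength (gam : R -> 'rV[R]_n) (a b : R) :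
  rectifiable_curve_in Om gam a b ->
  exists (sig : R -> 'rV[R]_n) (L : R),
    [/\ unit_speed_path Om sig L, sig 0 = gam a, sig L = gam b,
      forall s, (gam @` `[a, b]) (sig s) &
      qh_length Om gam a b =
      (\int[@lebesgue_measure R]_(s in `[0%R, L])
         ((delta Om (sig s))^-1)%:E)%E].
Proof.
move=> [ab cg gOm lenb]; pose len := curve_length gam a.
have len_fin t : a <= t <= b -> len t = (fine (len t))%:E.
  move=> /andP[at_ tb]; rewrite fineK// ge0_fin_numE ?curve_length_ge0//.
  exact: le_lt_trans (curve_length_homo gam at_ tb) lenb.
pose L := fine (len b); have bL : len b = L%:E by rewrite len_fin ?ab//=.
have L0 : 0 <= L by rewrite -lee_fin -bL curve_length_ge0.
pose sig s := gam (arrival gam a b (Num.min s L)).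
have minL s : ((Num.min s L)%:E <= len b)%E.
  by rewrite bL lee_fin ge_min lexx orbT.
have sig_len t : a <= t <= b -> sig (fine (len t)) = gam t.
  move=> /[dup] tab /andP[at_ tb]; rewrite /sig min_l; last first.
    by rewrite -lee_fin -bL -len_fin// curve_length_homo.
  by apply: arrival_curve_length => //; rewrite -len_fin.
have sig_lip : lipschitz1 sig.
  have lip_le s t : s <= t -> enorm (sig s - sig t) <= `|s - t|.
    move=> st; have mst : Num.min s L <= Num.min t L.
      by rewrite le_min !ge_min st lexx orbT.
    apply: (le_trans (lipschitz_arrival ab cg mst (minL t))).
    rewrite ler0_norm ?subr_le0// opprB.
    by have [|] := leP s L; have [|] := leP t L; lra.
  move=> s t; have [|/ltW ts] := leP s t; first exact: lip_le.
  by rewrite enorm_distC distrC; exact: lip_le.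
have sigL : sig L = gam b by rewrite -(sig_len b) ?ab ?lexx.
have sig0 : sig 0 = gam a.
  rewrite /sig min_l//; congr gam; apply/eqP; rewrite eq_le.
  rewrite arrival_le ?lexx ?ab//=; last exact: curve_length_ge0.
  by have := minL 0; rewrite min_l// => /(arrival_itv ab)/andP[].
have sig_im s : (gam @` `[a, b]) (sig s).
  exists (arrival gam a b (Num.min s L)) => //=.
  by rewrite in_itv/=; exact: arrival_itv.
exists sig, L; split; [|exact: sig0|exact: sigL|exact: sig_im|].
- split; [exact: L0|exact: sig_lip| |].
    rewrite -bL; apply: (curve_length_reparam (h := fine \o len)).
    + move=> s t; rewrite !in_itv/= => /andP[sa sb] /andP[ta tb] st.
      by rewrite -lee_fin -!len_fin ?sa ?ta// curve_length_homo.
    + by rewrite /= -lee_fin -len_fin ?lexx ?ab// curve_length_ge0.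
    + by [].
    + by move=> t; rewrite in_itv/= => tab; rewrite sig_len.
  by move=> s _; exact: gOm.
- have lenbE : curve_length gam a b = L%:E := bL.
  rewrite /qh_length (_ : [set s : R | 0 <= s /\
    (s%:E <= curve_length gam a b)%E] = `[0, L]%classic); last first.
    apply/seteqP; split => s /=; rewrite in_itv/= lenbE lee_fin.
      by move=> [-> ->].
    by move=> /andP[].
  apply: eq_integral => s; rewrite inE/= in_itv/= => /andP[s0 sL].
  by rewrite /sig min_l.
Qed.

(** A unit speed path is its own arc length parametrization. *)
Lemma unit_speed_path_qh_dist (sig : R -> 'rV[R]_n) (L : R) :
  unit_speed_path Om sig L ->
  (qh_dist Om (sig 0%R) (sig L) <=
   \int[@lebesgue_measure R]_(s in `[0%R, L]) ((delta Om (sig s))^-1)%:E)%E.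
Proof.
move=> /[dup] sigP [L0 lip lenL sOm].
have lenE s : 0 <= s <= L -> curve_length sig 0 s = s%:E.
  by move=> /andP[s0 sL]; rewrite (unit_speed_curve_length sigP) ?subr0.
apply: ereal_inf_lbound; exists sig, 0, L; split; [|by []|by []|].
  split; [by []| | |].
  - apply: continuous_subspaceT => s; apply/cvgrPdist_lt => e e0.
    near=> t; apply: (le_lt_trans (ler_norm_enorm _)).
    apply: (le_lt_trans (lip _ _)).
    near: t; exact: (@nbhsx_ballx _ R s _ e0).
  - by move=> _ [s /= /[!in_itv]/= sL <-]; exact: sOm.
  - by rewrite lenE ?L0 ?lexx// ltry.
rewrite /qh_length lenE; last by rewrite L0 lexx.
rewrite (_ : [set s : R | 0 <= s /\ (s%:E <= L%:E)%E] =
  `[0, L]%classic); last first.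
  apply/seteqP; split => s /=; rewrite in_itv/= lee_fin.
    by move=> [-> ->].
  by move=> /andP[].
apply: eq_integral => s; rewrite inE/= in_itv/= => /andP[s0 sL].
congr ((delta Om _)^-1%:E); rewrite /arclength_param; congr sig.
rewrite (_ : [set t | _] = `[s, L]%classic) ?inf_itv//.
apply/seteqP; split => t /=; rewrite !in_itv/=.
  by move=> [/andP[t0 tL]]; rewrite lenE ?t0// lee_fin => ->.
move=> /andP[st tL].
by rewrite (le_trans s0 st) tL lenE ?lee_fin ?tL ?(le_trans s0 st).
Unshelve. all: by end_near. Qed.

End arclength_reparametrization.

(** * Distance to the boundary *)

Section boundary_distance.
Variables (R : realType) (n : nat) (Om : set 'rV[R]_n).
Hypothesis bdry : euc_boundary Om !=set0.

Lemma delta_le (x p : 'rV[R]_n) : euc_boundary Om p ->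
  delta Om x <= enorm (x - p).
Proof.
move=> Bp; apply: ge_inf; last by exists p.
by exists 0 => _ [q _ <-]; exact: enorm_ge0.
Qed.

Lemma le_delta (x : 'rV[R]_n) (r : R) :
  (forall p, euc_boundary Om p -> r <= enorm (x - p)) -> r <= delta Om x.
Proof.
move=> H; apply: lb_le_inf => [|_ [p Bp <-]]; last exact: H.
by case: bdry => p Bp; exists (enorm (x - p)); exists p.
Qed.

Lemma delta_triangle (x y : 'rV[R]_n) :
  delta Om x <= delta Om y + enorm (x - y).
Proof.
rewrite -lerBlDr; apply: le_delta => p Bp; rewrite lerBlDl.
exact: le_trans (delta_le _ Bp) (ler_edistD _ _ _).
Qed.

Lemma delta_lipschitz (x y : 'rV[R]_n) :
  `|delta Om x - delta Om y| <= enorm (x - y).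
Proof.
rewrite ler_norml lerBlDl delta_triangle lerNl opprB lerBlDl andbT.
by rewrite enorm_distC delta_triangle.
Qed.

Lemma delta_gt0 (x : 'rV[R]_n) : open Om -> Om x -> 0 < delta Om x.
Proof.
move=> oOm Omx; have [r r0 rOm] := nbhs_enormP (oOm _ Omx).
apply: (lt_le_trans r0); apply: le_delta => p [_ pOm].
rewrite leNgt; apply/negP => /rOm Omp; apply: pOm.
by move/interior_id : oOm => ->.
Qed.

(** A limit of points of Om lying outside Om is a boundary point, where delta
    vanishes. *)
Lemma closure_delta_gt0 (x : 'rV[R]_n) :
  open Om -> closure Om x -> 0 < delta Om x -> Om x.
Proof.
move=> oOm clx dx; apply: contrapT => Omx.
have : euc_boundary Om x by split=> // /interior_subset.
by move=> /(delta_le x); rewrite subrr enorm0 leNgt dx.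
Qed.

End boundary_distance.

(** * Quasihyperbolic cost of unit speed paths *)

Lemma integral_reflect (R : realType) (G : R -> R) (a b c : R) : a <= b ->
  {within `[c - b, c - a], continuous G} ->
  (\int[@lebesgue_measure R]_(x in `[(c - b)%R, (c - a)%R]) (G x)%:E =
   \int[@lebesgue_measure R]_(x in `[a, b]) (G (c - x))%:E)%E.
Proof.
move=> ab cG; pose F x : R := c - x.
have DF : F^`()%classic = cst (-1).
  by apply/funext => x; rewrite derive1E deriveB// derive_id derive_cst sub0r.
have cF : continuous F.
  by move=> x; apply: continuousB => //; exact: cvg_cst.
rewrite (@integration_by_substitution_decreasing _ F)//.
- by apply: eq_integral => x _; rewrite !fctE DF opprK mulr1.
- by move=> x y _ _ xy; rewrite /F ltrD2l ltrN2.
- by rewrite DF => ? ?; exact: cvg_cst.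
- by rewrite DF; exact: is_cvg_cst.
- by rewrite DF; exact: is_cvg_cst.
- split => /=.
  + by move=> x _; exact: derivableB.
  + by apply: cvg_at_right_filter; exact: cF.
  + by apply: cvg_at_left_filter; exact: cF.
Qed.

Lemma integral_translate (R : realType) (G : R -> R) (a b c : R) : a <= b ->
  {within `[a + c, b + c], continuous G} ->
  (\int[@lebesgue_measure R]_(x in `[(a + c)%R, (b + c)%R]) (G x)%:E =
   \int[@lebesgue_measure R]_(x in `[a, b]) (G (x + c))%:E)%E.
Proof.
move=> ab cG; pose F x : R := x + c.
have DF : F^`()%classic = cst 1.
  by apply/funext => x; rewrite derive1E deriveD// derive_id derive_cst addr0.
have cF : continuous F.
  by move=> x; apply: continuousD => //; exact: cvg_cst.
rewrite (@integration_by_substitution_increasing _ F)//.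
- by apply: eq_integral => x _; rewrite !fctE DF mulr1.
- by move=> x y _ _ xy; rewrite /F ltrD2r.
- by rewrite DF => ? ?; exact: cvg_cst.
- by rewrite DF; exact: is_cvg_cst.
- by rewrite DF; exact: is_cvg_cst.
- split => /=.
  + by move=> x _; exact: derivableD.
  + by apply: cvg_at_right_filter; exact: cF.
  + by apply: cvg_at_left_filter; exact: cF.
Qed.

Definition qh_cost (R : realType) (n : nat) (Om : set 'rV[R]_n)
    (sig : R -> 'rV[R]_n) (u v : R) : \bar R :=
  (\int[@lebesgue_measure R]_(s in `[u, v]) ((delta Om (sig s))^-1)%:E)%E.

Section qh_cost.
Variables (R : realType) (n : nat) (Om : set 'rV[R]_n).
Hypothesis bdry : euc_boundary Om !=set0.
Hypothesis oOm : open Om.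
Implicit Types (sig : R -> 'rV[R]_n) (L u v w s : R).

Lemma continuous_delta_path sig : lipschitz1 sig ->
  continuous (fun s => delta Om (sig s)).
Proof.
move=> lip s; apply/cvgrPdist_lt => e e0; near=> t.
apply: (le_lt_trans (delta_lipschitz bdry _ _)).
apply: (le_lt_trans (lip _ _)).
near: t; exact: (@nbhsx_ballx _ R s _ e0).
Unshelve. all: by end_near. Qed.

Lemma delta_path_gt0 sig L s : unit_speed_path Om sig L -> 0 <= s <= L ->
  0 < delta Om (sig s).
Proof. by move=> [_ _ _ sOm] sL; apply: delta_gt0 => //; exact: sOm. Qed.

Lemma continuous_qh_density sig L u v : unit_speed_path Om sig L ->
  0 <= u -> v <= L ->
  {within `[u, v], continuous (fun s => (delta Om (sig s))^-1)}.
Proof.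
move=> sigP u0 vL; apply: (@continuous_in_subspaceT R R) => s.
rewrite inE/= in_itv/= => /andP[us sv]; have [_ lip _ _] := sigP.
have ds : delta Om (sig s) != 0.
  by rewrite gt_eqF// (delta_path_gt0 sigP)// (le_trans u0 us) (le_trans sv vL).
have cs := @continuous_delta_path _ lip s.
exact: (@continuousV _ _ (fun r => delta Om (sig r)) s ds cs).
Qed.

Lemma measurable_qh_density sig L u v : unit_speed_path Om sig L ->
  0 <= u -> v <= L ->
  measurable_fun `[u, v] (EFin \o (fun s => (delta Om (sig s))^-1)).
Proof.
move=> sigP u0 vL; apply/measurable_EFinP.
apply: subspace_continuous_measurable_fun => //.
exact: continuous_qh_density sigP u0 vL.
Qed.

Lemma qh_density_ge0 sig L u v s : unit_speed_path Om sig L ->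
  0 <= u -> v <= L -> `[u, v]%classic s ->
  (0 <= ((delta Om (sig s))^-1)%:E)%E.
Proof.
move=> sigP u0 vL /=; rewrite in_itv/= => /andP[us sv].
rewrite lee_fin invr_ge0 ltW// (delta_path_gt0 sigP)//.
by rewrite (le_trans u0 us) (le_trans sv vL).
Qed.

Lemma qh_cost_ge0 sig L u v : unit_speed_path Om sig L ->
  0 <= u -> v <= L -> (0 <= qh_cost Om sig u v)%E.
Proof.
move=> sigP u0 vL; apply: integral_ge0 => s.
exact: qh_density_ge0 sigP u0 vL.
Qed.

Lemma qh_cost_fin_num sig L u v : unit_speed_path Om sig L ->
  0 <= u -> v <= L -> qh_cost Om sig u v \is a fin_num.
Proof.
move=> sigP u0 vL; apply: integrable_fin_num => //=.
apply: continuous_compact_integrable; first exact: segment_compact.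
exact: continuous_qh_density sigP u0 vL.
Qed.

Lemma qh_cost_add sig L u v w : unit_speed_path Om sig L ->
  0 <= u -> u <= v -> v <= w -> w <= L ->
  (qh_cost Om sig u w = qh_cost Om sig u v + qh_cost Om sig v w)%E.
Proof.
move=> sigP u0 uv vw wL; have v0 := le_trans u0 uv.
rewrite /qh_cost (@itv_bndbnd_setU _ _ _ (BRight v)) ?bnd_simp//.
have mU : measurable_fun (`[u, v] `|` `]v, w])
    (EFin \o (fun s => (delta Om (sig s))^-1)).
  rewrite -itv_bndbnd_setU ?bnd_simp//.
  exact: measurable_qh_density sigP u0 wL.
rewrite ge0_integral_setU//=.
- rewrite integral_itv_obnd_cbnd//.
  by apply: measurable_funS mU; [exact: measurableU|exact: subsetUr].
- move=> s [] /=; rewrite !in_itv/= => /andP[h1 h2];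
    apply: (qh_density_ge0 sigP u0 wL); rewrite /= in_itv/=.
    by rewrite h1 (le_trans h2).
  by rewrite h2 (le_trans uv (ltW h1)).
- apply/disj_setPS => s /= []; rewrite !in_itv/= => /andP[_ sv] /andP[vs _].
  by rewrite ltNge sv in vs.
Qed.

Lemma qh_cost_bound sig L u v (D : R) : unit_speed_path Om sig L ->
  0 <= u -> u <= v -> v <= L -> 0 < D ->
  (forall s, u <= s <= v -> delta Om (sig s) <= D) ->
  (((v - u) / D)%:E <= qh_cost Om sig u v)%E.
Proof.
move=> sigP u0 uv vL D0 dD.
apply: (@le_trans _ _ (\int[@lebesgue_measure R]_(s in `[u, v]) (D^-1)%:E)%E).
  rewrite integral_cst//= lebesgue_measure_itv/= lte_fin.
  move: uv; rewrite le_eqVlt => /predU1P[->|uv].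
    by rewrite ltxx subrr mul0r mule0.
  by rewrite uv -EFinD -EFinM mulrC.
apply: ge0_le_integral => //.
- by move=> s _; rewrite lee_fin invr_ge0 ltW.
- exact: measurable_qh_density sigP u0 vL.
- move=> s /=; rewrite in_itv/= => suv; rewrite lee_fin lef_pV2 ?posrE ?dD//.
  apply: (delta_path_gt0 sigP); move: suv => /andP[us sv].
  by rewrite (le_trans u0 us) (le_trans sv vL).
Qed.

Lemma qh_cost_rev sig L u v (c : R) : unit_speed_path Om sig L ->
  0 <= u -> u <= v -> v <= L ->
  qh_cost Om (fun s => sig (c - s)) (c - v) (c - u) = qh_cost Om sig u v.
Proof.
move=> sigP u0 uv vL; rewrite /qh_cost.
have := @integral_reflect _ (fun s => (delta Om (sig s))^-1) (c - v) (c - u) c.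
rewrite !subKr => <-//; first by rewrite lerD2l lerN2.
exact: continuous_qh_density sigP _ _.
Qed.

Lemma qh_cost_sub sig L u v : unit_speed_path Om sig L ->
  0 <= u -> u <= v -> v <= L ->
  qh_cost Om (fun s => sig (s + u)) 0 (v - u) = qh_cost Om sig u v.
Proof.
move=> sigP u0 uv vL.
rewrite /qh_cost; have := @integral_translate _
  (fun s => (delta Om (sig s))^-1) 0 (v - u) u.
rewrite add0r subrK => <-//; first by rewrite subr_ge0.
exact: continuous_qh_density sigP _ _.
Qed.

Lemma qh_cost_cat sig1 sig2 L1 L2 :
  unit_speed_path Om sig1 L1 -> unit_speed_path Om sig2 L2 ->
  sig1 L1 = sig2 0 ->
  qh_cost Om (path_cat sig1 sig2 L1) 0 (L1 + L2) =
  (qh_cost Om sig1 0 L1 + qh_cost Om sig2 0 L2)%E.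
Proof.
move=> P1 P2 glue; have P := unit_speed_path_cat P1 P2 glue.
have [L10 _ _ _] := P1; have [L20 _ _ _] := P2.
have L12 : L1 <= L1 + L2 by rewrite lerDl.
have costl : qh_cost Om (path_cat sig1 sig2 L1) 0 L1 = qh_cost Om sig1 0 L1.
  apply: eq_integral => s; rewrite inE/= in_itv/= => /andP[_ sL].
  by rewrite path_catl.
have costr : qh_cost Om (path_cat sig1 sig2 L1) L1 (L1 + L2) =
    qh_cost Om sig2 0 L2.
  rewrite -(qh_cost_sub P L10 L12 (lexx _)) addrAC subrr add0r.
  apply: eq_integral => s; rewrite inE/= in_itv/= => /andP[s0 _].
  by rewrite path_catr.
have costD := qh_cost_add P (lexx 0) L10 L12 (lexx (L1 + L2)).
exact: (etrans costD (f_equal2 adde costl costr)).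
Qed.

End qh_cost.

(** * The quasihyperbolic metric *)

Section qh_dist.
Variables (R : realType) (n : nat) (Om : set 'rV[R]_n).
Hypothesis bdry : euc_boundary Om !=set0.
Hypothesis oOm : open Om.
Implicit Types (x y z : 'rV[R]_n).

(** The distance is an infimum over unit speed paths; on these, reversal and
    concatenation are substitutions in the integral, whence the metric
    properties. *)
Lemma le_qh_dist x y (l : \bar R) :
  (forall (sig : R -> 'rV[R]_n) (L : R), unit_speed_path Om sig L ->
     sig 0 = x -> sig L = y -> (l <= qh_cost Om sig 0 L)%E) ->
  (l <= qh_dist Om x y)%E.
Proof.
move=> H; apply: le_ereal_inf_tmp => _ [gam [a [b [gamP ga gb ->]]]].
have [sig [L [sigP sig0 sigL _ ->]]] := unit_speed_path_arclength gamP.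
by apply: H; rewrite ?sig0 ?sigL.
Qed.

Lemma qh_dist_ge0 x y : (0 <= qh_dist Om x y)%E.
Proof.
by apply: le_qh_dist => sig L sigP _ _; exact: (qh_cost_ge0 bdry oOm sigP).
Qed.

Lemma qh_dist_sym x y : qh_dist Om x y = qh_dist Om y x.
Proof.
have le_sym x' y' : (qh_dist Om x' y' <= qh_dist Om y' x')%E.
  apply: le_qh_dist => sig L sigP sig0 sigL.
  have := unit_speed_path_qh_dist (unit_speed_path_rev sigP).
  have [L0 _ _ _] := sigP.
  have := qh_cost_rev bdry oOm L sigP (lexx 0) L0 (lexx L).
  by rewrite /qh_cost !subr0 subrr sig0 sigL => ->.
by apply/eqP; rewrite eq_le !le_sym.
Qed.

Lemma qh_dist_triangle y x z :
  (qh_dist Om x z <= qh_dist Om x y + qh_dist Om y z)%E.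
Proof.
have [yz_oo|yz_oo] := eqVneq (qh_dist Om y z) +oo%E.
  by rewrite yz_oo addey ?leey// gt_eqF// (lt_le_trans _ (qh_dist_ge0 _ _)).
have yz_fin : qh_dist Om y z \is a fin_num.
  by rewrite ge0_fin_numE ?qh_dist_ge0// lt_neqAle yz_oo leey.
rewrite -leeBlDr//; apply: le_qh_dist => sig1 L1 P1 s10 s1L.
have c1_fin : qh_cost Om sig1 0 L1 \is a fin_num.
  exact: (qh_cost_fin_num bdry oOm P1).
rewrite leeBlDr// addeC -leeBlDr//; apply: le_qh_dist => sig2 L2 P2 s20 s2L.
rewrite leeBlDr// addeC.
have glue : sig1 L1 = sig2 0 by rewrite s1L s20.
have := unit_speed_path_qh_dist (unit_speed_path_cat P1 P2 glue).
rewrite -/(qh_cost _ _ _ _) (qh_cost_cat bdry oOm P1 P2 glue).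
have [L10 _ _ _] := P1; have [L20 _ _ _] := P2.
rewrite /path_cat L10 s10; have [L2_le0|_] := leP (L1 + L2) L1.
  have -> : L1 + L2 = L1 by lra.
  have L2E : L2 = 0 by lra.
  by rewrite s1L -s20 -L2E s2L.
by rewrite addrAC subrr add0r s2L.
Qed.

(** At arc length s along a path leaving y, delta is at most delta y + s; the
    integral of 1 / (delta y + s) up to a length L with delta y + L >= delta x
    is at least the logarithm. *)
Lemma ln_le_qh_dist x y : Om x -> Om y ->
  ((ln (delta Om x / delta Om y))%:E <= qh_dist Om x y)%E.
Proof.
move=> Omx Omy; rewrite qh_dist_sym; set D := delta Om y.
have D0 : 0 < D by exact: delta_gt0.
have dx0 : 0 < delta Om x by exact: delta_gt0.
apply: le_qh_dist => sig L sigP sig0 sigL.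
have [L0 lip _ _] := sigP.
have dsig s : 0 <= s -> delta Om (sig s) <= D + s.
  move=> s0; apply: (le_trans (delta_triangle bdry _ y)); rewrite lerD2l -sig0.
  by rewrite (le_trans (lip _ _))// subr0 ger0_norm.
move: (L0); rewrite le_eqVlt => /predU1P[L0E|Lgt0].
  rewrite -sigL -L0E sig0 divff ?ln1; last by rewrite gt_eqF.
  exact: (qh_cost_ge0 bdry oOm sigP).
pose F (s : R) : R := ln (D + s); pose f (s : R) : R := (D + s)^-1.
have Ds (s : R) : 0 <= s -> 0 < D + s by move=> s0; rewrite ltr_wpDr.
have dF (s : R) : 0 <= s -> is_derive s 1 F (f s).
  move=> s0; have := @is_derive1_ln R (D + s) (Ds _ s0) => dln.
  have -> : f s = f s * (0 + 1) by rewrite add0r mulr1.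
  apply: (@is_derive1_comp _ (@ln R) (fun s => D + s)).
have cF (s : R) : 0 <= s -> {for s, continuous F}.
  by move=> /dF [dFs _]; apply/differentiable_continuous/derivable1_diffP.
have cf : {within `[0, L], continuous f}.
  apply: (@continuous_in_subspaceT R R) => s.
  rewrite inE/= in_itv/= => /andP[s0 _].
  have ds : D + s != 0 by rewrite gt_eqF ?Ds.
  have cs : {for s, continuous (fun s : R => D + s)}.
    by apply: continuousD => //; exact: cvg_cst.
  exact: (@continuousV _ _ _ s ds cs).
have FTC : (\int[@lebesgue_measure R]_(s in `[0%R, L]) (f s)%:E =
    (F L)%:E - (F 0)%:E)%E.
  apply: continuous_FTC2 => //.
  - split.
    + by move=> s; rewrite in_itv/= => /andP[/ltW/dF[]].
    + by apply: cvg_at_right_filter; exact: cF.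
    + by apply: cvg_at_left_filter; exact: cF.
  - move=> s; rewrite in_itv/= => /andP[/ltW/dF[_ dFs] _].
    by rewrite derive1E.
have : ((ln (delta Om x / D))%:E <= (F L)%:E - (F 0)%:E)%E.
  rewrite -EFinB lee_fin /F addr0 ln_div ?posrE// lerB// ler_ln ?posrE ?Ds//.
  by rewrite -sigL dsig.
move=> /le_trans; apply; rewrite -FTC; apply: ge0_le_integral => //=.
- move=> s; rewrite in_itv/= => /andP[s0 _].
  by rewrite lee_fin invr_ge0 ltW ?Ds.
- apply/measurable_EFinP; exact: subspace_continuous_measurable_fun.
- exact: (measurable_qh_density bdry oOm sigP).
- move=> s; rewrite in_itv/= => /andP[s0 sL].
  rewrite lee_fin lef_pV2 ?posrE ?dsig ?Ds//.
  by apply: (delta_path_gt0 bdry oOm sigP); rewrite s0 sL.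
Qed.

End qh_dist.

(** * Discrete estimates *)

(** A discrete substitute for the change of variables t = tau u in the integral
    of 1: each piece of [0, L] on which tau grows by c between multiples of c is
    short because H is small there. *)
Lemma length_le_discrete_sum (R : realType) (tau H : R -> R) (L c : R) :
  0 < c -> tau 0 = 0 ->
  (forall t, 0 <= t -> 0 <= H t) ->
  (forall s t, 0 <= s -> s <= t -> H t <= H s) ->
  (forall u v, 0 <= u -> u <= v -> v <= L -> tau u <= tau v) ->
  (forall u v, 0 <= u -> u <= v -> v <= L ->
     v - u <= H (tau u) * (tau v - tau u)) ->
  forall (j : nat) (u : R), 0 <= u -> u <= L -> tau u <= c * j%:R ->
  u <= c * \sum_(0 <= i < j) H (c * i%:R).
Proof.
move=> c0 tau0 H0 Hni taum Hlen.
have tau_ge0 u : 0 <= u -> u <= L -> 0 <= tau u.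
  by move=> u0 uL; rewrite -tau0 taum.
elim=> [|j IH] u u0 uL tau_u.
  rewrite big_nil mulr0 -[u]subr0.
  apply: (le_trans (Hlen 0 u (lexx 0) u0 uL)); rewrite tau0 subr0.
  by rewrite mulr_ge0_le0 ?H0//; rewrite mulr0 in tau_u.
rewrite big_nat_recr//= mulrDr leNgt; apply/negP => u_gt.
set B := c * \sum_(0 <= i < j) _ in IH u_gt; set h := c * H _ in u_gt.
have cj0 : 0 <= c * j%:R by rewrite mulr_ge0// ltW.
have c_ge0 := ltW c0.
have B0 : 0 <= B.
  by rewrite mulr_ge0// sumr_ge0// => i _; rewrite H0// mulr_ge0.
have h0 : 0 <= h by rewrite mulr_ge0// H0.
(* v is beyond the reach B of the first j steps, yet farther than h from u *)
pose v := (B + (u - h)) / 2.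
have [v0 vu] : 0 <= v /\ v <= u by rewrite /v; split; lra.
have tau_v : c * j%:R < tau v.
  rewrite ltNge; apply/negP => /(IH v v0 (le_trans vu uL)).
  by rewrite -/B /v; lra.
have := Hlen v u v0 vu uL; apply/negP; rewrite -ltNge.
apply: (@le_lt_trans _ _ h); last by rewrite /v; lra.
rewrite /h [c * _]mulrC; apply: ler_pM; rewrite ?subr_ge0 ?taum//.
- by rewrite H0// tau_ge0// (le_trans vu).
- by apply: Hni => //; exact: ltW.
- by rewrite -natr1 mulrDr mulr1 in tau_u; lra.
Qed.

(** The first n terms, all equal to a n, sum to n * a n. If the tail of the
    series after M is small and n = 2 M, then so is n * a n, which is at most
    twice the sum of the block of terms from M to n. *)
Lemma truncated_sum_small (R : realType) (a : nat -> R) (C e : R) :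
  (forall i, 0 <= a i) -> (forall i j, (i <= j)%N -> a j <= a i) ->
  (forall N, \sum_(1 <= i < N) a i <= C) -> 0 < e ->
  exists2 n, (0 < n)%N & forall N, \sum_(0 <= i < N) a (maxn n i) <= e.
Proof.
move=> a0 ani aC e0.
have e4 : 0 < e / 4 by rewrite divr_gt0.
pose S := [set \sum_(1 <= i < N) a i | N in [set: nat]].
have supS : has_sup S.
  split; first by exists (\sum_(1 <= i < 0) a i); exists 0%N.
  by exists C => _ [N _ <-].
have [_ [N0 _ <-] N0S] := sup_adherent e4 supS.
have le_supS N : \sum_(1 <= i < N) a i <= sup S.
  by apply: ub_le_sup; [exact: supS.2|exists N].
pose M := N0.+1.
have tail N : (M <= N)%N -> \sum_(M <= i < N) a i <= e / 4.
  move=> MN; have := le_supS N; rewrite (@big_cat_nat _ _ _ M)//=.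
  have : \sum_(1 <= i < N0) a i <= \sum_(1 <= i < M) a i.
    rewrite /M; case: (N0) => [|k]; first by rewrite !big_geq.
    by rewrite [leRHS]big_nat_recr//= lerDl.
  by lra.
exists (M + M)%N; first by [].
have head : a (M + M)%N *+ (M + M) <= e / 2.
  suff : a (M + M)%N *+ M <= e / 4 by rewrite mulrnDr; lra.
  apply: le_trans (tail _ (leq_addr M M)).
  rewrite -[X in _ *+ X](addnK M) -sumr_const_nat.
  rewrite big_nat_cond [leRHS]big_nat_cond; apply: ler_sum => i.
  by rewrite andbT => /andP[_ iM]; apply: ani; exact: ltnW.
move=> N; apply: (@le_trans _ _ (\sum_(0 <= i < M + M + N) a (maxn (M + M) i))).
  by rewrite [leRHS](@big_cat_nat _ _ _ N) ?leq_addl//= lerDl sumr_ge0.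
rewrite (@big_cat_nat _ _ _ (M + M)) ?leq_addr//=.
have -> : e = e / 2 + e / 2 by lra.
apply: lerD.
  apply: le_trans head; rewrite -[X in _ *+ X]subn0 -sumr_const_nat.
  rewrite big_nat_cond [leRHS]big_nat_cond; apply: ler_sum => i.
  by rewrite andbT => /andP[_ iM]; rewrite (maxn_idPl _)// ltnW.
apply: (@le_trans _ _ (e / 4)); last by lra.
apply: le_trans (tail (M + M + N)%N _); last by lia.
rewrite [leRHS](@big_cat_nat _ _ _ (M + M)) ?leq_addr//=.
apply: (@le_trans _ _ (\sum_(M + M <= i < M + M + N) a i)).
  rewrite big_nat_cond [leRHS]big_nat_cond; apply: ler_sum => i.
  by rewrite andbT => /andP[iM _]; rewrite (maxn_idPr _).
by rewrite lerDr sumr_ge0.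
Qed.

Lemma nonincreasing_emeasurable (R : realType) (D : set R) (f : R -> \bar R) :
  measurable D -> (forall s t, s <= t -> (f t <= f s)%E) -> measurable_fun D f.
Proof.
move=> mD fni.
apply: (measurability (@ErealGenCInfty.G R)) => [|/= _ [_] [r] -> <-].
  exact: ErealGenCInfty.measurableE.
apply: measurableI => //; apply: is_interval_measurable => s t/=.
rewrite !in_itv/= !andbT => fs ft u /andP[su ut].
by rewrite in_itv/= andbT (le_trans ft)// fni.
Qed.

(** * The summable rate of decay attached to phi *)

Section growth_rate.
Variables (R : realType) (phi : R -> R).
Hypothesis phi_int : (\int[@lebesgue_measure R]_(t in `]0%R, +oo[)
                        (ginv phi t)^-1 < +oo)%E.

Lemma ginv_ge0 (t : R) : (0 <= ginv phi t)%E.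
Proof.
by apply: le_ereal_inf_tmp => _ [s [s0 _] <-]; rewrite lee_fin ltW.
Qed.

Lemma ginv_homo (s t : R) : s <= t -> (ginv phi s <= ginv phi t)%E.
Proof.
move=> st; apply: le_ereal_inf_tmp => _ [r [r0 tr] <-].
by apply: ereal_inf_lbound; exists r => //; split=> //; exact: le_trans tr.
Qed.

Let inv_ginv_nonincreasing (s t : R) : s <= t ->
  ((ginv phi t)^-1 <= (ginv phi s)^-1)%E.
Proof. by move=> st; rewrite lee_pV2 ?inE ?ginv_ge0 ?ginv_homo. Qed.

(** Capping 1 / phi^-1 at 1 makes it real valued without harming the estimates,
    which concern large values of phi^-1 only. *)
Definition decay_rate (t : R) : R := fine (Order.min 1%E (ginv phi t)^-1%E).

Let decay_rateE t : (decay_rate t)%:E = Order.min 1%E (ginv phi t)^-1%E.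
Proof.
rewrite fineK// ge0_fin_numE.
  by rewrite (@le_lt_trans _ _ 1%E) ?ltry// ge_min lexx.
by rewrite le_min lee_fin ler01/= inve_ge0 ginv_ge0.
Qed.

Lemma decay_rate_ge0 t : 0 <= decay_rate t.
Proof.
by rewrite -lee_fin decay_rateE le_min lee_fin ler01/= inve_ge0 ginv_ge0.
Qed.

Lemma decay_rate_nonincreasing s t : s <= t -> decay_rate t <= decay_rate s.
Proof.
move=> st; rewrite -lee_fin !decay_rateE le_min !ge_min lexx/=.
by rewrite inv_ginv_nonincreasing ?orbT.
Qed.

Lemma inv_le_decay_rate s t : 1 <= s -> t <= phi s -> s^-1 <= decay_rate t.
Proof.
move=> s1 ts; have s0 : 0 < s by rewrite (lt_le_trans ltr01).
rewrite -lee_fin decay_rateE le_min lee_fin invf_le1// s1/=.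
have -> : (s^-1)%:E = (s%:E)^-1%E by rewrite inver gt_eqF.
rewrite lee_pV2 ?inE ?ginv_ge0 ?lee_fin ?(ltW s0)//.
by apply: ereal_inf_lbound; exists s.
Qed.

Let h t := (decay_rate t)%:E.

Let measurable_h (D : set R) : measurable D -> measurable_fun D h.
Proof.
move=> mD; apply: nonincreasing_emeasurable => // s t st.
by rewrite lee_fin decay_rate_nonincreasing.
Qed.

Lemma decay_rate_sum_le_integral (N : nat) :
  ((\sum_(1 <= i < N.+1) decay_rate i%:R)%:E <=
   \int[@lebesgue_measure R]_(t in `]0%R, N%:R]) h t)%E.
Proof.
elim: N => [|N IH].
  by rewrite big_geq// integral_ge0// => t _; rewrite lee_fin decay_rate_ge0.
rewrite big_nat_recr//= EFinD.
rewrite (@itv_bndbnd_setU _ _ _ (BRight N%:R)) ?bnd_simp ?ler_nat//.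
rewrite ge0_integral_setU//=; first last.
- apply/disj_setPS => s /= []; rewrite !in_itv/= => /andP[_ sv] /andP[vs _].
  by rewrite ltNge sv in vs.
- by move=> t _; rewrite lee_fin decay_rate_ge0.
- by apply: measurable_h; exact: measurableU.
apply: leeD => //.
apply: (@le_trans _ _ (\int[@lebesgue_measure R]_(t in `]N%:R, N.+1%:R])
    (decay_rate N.+1%:R)%:E)%E).
  rewrite integral_cst//= lebesgue_measure_itv/= lte_fin ltr_nat ltnSn.
  by rewrite -EFinD -EFinM lee_fin -natr1 addrAC subrr add0r mulr1.
apply: ge0_le_integral => //.
- by move=> t _; rewrite lee_fin decay_rate_ge0.
- exact: measurable_h.
- move=> t /=; rewrite in_itv/= => /andP[_ tN].
  by rewrite lee_fin decay_rate_nonincreasing.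
Qed.

Lemma decay_rate_summable :
  exists C : R, forall N, \sum_(1 <= i < N) decay_rate i%:R <= C.
Proof.
have mg (D : set R) : measurable D ->
    measurable_fun D (fun t => (ginv phi t)^-1%E).
  by move=> mD; apply: nonincreasing_emeasurable.
have hg t : (h t <= (ginv phi t)^-1)%E.
  by rewrite /h decay_rateE ge_min lexx orbT.
have h0 t : (0 <= h t)%E by rewrite lee_fin decay_rate_ge0.
have I_lty := phi_int; set I := (\int[_]_(_ in _) _)%E in I_lty.
have I0 : (0 <= I)%E by apply: integral_ge0 => t _; exact: le_trans (hg t).
exists (fine I) => -[|N]; first by rewrite big_nil fine_ge0.
rewrite -lee_fin fineK ?ge0_fin_numE//.
apply: (le_trans (decay_rate_sum_le_integral N)).
apply: (@le_trans _ _ (\int[@lebesgue_measure R]_(t in `]0%R, +oo[) h t)%E).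
  apply: ge0_subset_integral => //; first exact: measurable_h.
  by move=> t /=; rewrite !in_itv/= andbT => /andP[].
by apply: ge0_le_integral => //; [exact: measurable_h|exact: mg].
Qed.

End growth_rate.

(** * Length of geodesics *)

Definition geodesic_path (R : realType) (n : nat) (Om : set 'rV[R]_n)
    (sig : R -> 'rV[R]_n) (L : R) :=
  unit_speed_path Om sig L /\
  forall u v, 0 <= u -> u <= v -> v <= L ->
    (qh_cost Om sig u v <= qh_dist Om (sig u) (sig v))%E.

Section geodesic_path.
Variables (R : realType) (n : nat) (Om : set 'rV[R]_n).
Hypothesis bdry : euc_boundary Om !=set0.
Hypothesis oOm : open Om.
Implicit Types (sig : R -> 'rV[R]_n) (L : R).

Lemma qh_dist_le_cost sig L u v : unit_speed_path Om sig L ->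
  0 <= u -> u <= v -> v <= L ->
  (qh_dist Om (sig u) (sig v) <= qh_cost Om sig u v)%E.
Proof.
move=> sigP u0 uv vL.
have := unit_speed_path_qh_dist (unit_speed_path_sub sigP u0 uv vL).
have := qh_cost_sub bdry oOm sigP u0 uv vL.
by rewrite /qh_cost add0r subrK => ->.
Qed.

(** Minimality between the endpoints passes to subpaths, by subtracting the
    costs of the two remaining pieces in the triangle inequality. *)
Lemma geodesic_path_of_endpoints sig L : unit_speed_path Om sig L ->
  (qh_cost Om sig 0 L <= qh_dist Om (sig 0%R) (sig L))%E ->
  geodesic_path Om sig L.
Proof.
move=> sigP min; split=> // u v u0 uv vL.
have [L0 _ _ _] := sigP.
have v0 := le_trans u0 uv; have uL := le_trans uv vL.
have fin := qh_cost_fin_num bdry oOm sigP.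
move: min; rewrite (qh_cost_add bdry oOm sigP (lexx 0) u0 uL (lexx L)).
rewrite (qh_cost_add bdry oOm sigP u0 uv vL (lexx L)).
have h1 := qh_dist_triangle bdry oOm (sig u) (sig 0) (sig L).
have h2 := qh_dist_triangle bdry oOm (sig v) (sig u) (sig L).
have h3 := qh_dist_le_cost sigP (lexx 0) u0 uL.
have h4 := qh_dist_le_cost sigP v0 vL (lexx L).
move=> /le_trans/(_ h1) H.
have {H} := le_trans H (leeD h3 h2); rewrite leeD2lE ?fin// => H.
have {H} := le_trans H (leeD (lexx _) h4).
by rewrite leeD2rE ?fin.
Qed.

Lemma geodesic_path_sub sig L u : geodesic_path Om sig L -> 0 <= u <= L ->
  geodesic_path Om (fun s => sig (s + u)) (L - u).
Proof.
move=> [sigP geo] /andP[u0 uL].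
apply: (geodesic_path_of_endpoints (unit_speed_path_sub sigP u0 uL (lexx L))).
rewrite add0r subrK (qh_cost_sub bdry oOm sigP u0 uL (lexx L)).
exact: geo.
Qed.

Lemma geodesic_path_rev sig L u : geodesic_path Om sig L -> 0 <= u <= L ->
  geodesic_path Om (fun s => sig (u - s)) u.
Proof.
move=> [sigP geo] /andP[u0 uL].
have subP := unit_speed_path_sub sigP (lexx 0) u0 uL.
have E : (fun s => sig (s + 0)) = sig by apply/funext => s; rewrite addr0.
rewrite E subr0 in subP.
apply: (geodesic_path_of_endpoints (unit_speed_path_rev subP)).
have := qh_cost_rev bdry oOm u sigP (lexx 0) u0 uL.
rewrite subrr subr0 => ->; rewrite (qh_dist_sym bdry oOm).
exact: geo.
Qed.

Variables (x0 : 'rV[R]_n) (h : R -> R) (m : nat) (S d0 : R).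
Hypothesis h_ge0 : forall t, 0 <= h t.
Hypothesis h_nonincreasing : forall s t, s <= t -> h t <= h s.
Hypothesis h_sum : forall N, \sum_(0 <= i < N) h (maxn m i)%:R <= S.
Hypothesis d0_ge0 : 0 <= d0.

Let dist0 sig s := fine (qh_dist Om x0 (sig s)).

Let slow sig L := forall s, 0 <= s <= L ->
  [/\ qh_dist Om x0 (sig s) \is a fin_num, m%:R <= dist0 sig s &
      delta Om (sig s) <= d0 * h (dist0 sig s)].

(** If the start almost minimizes the distance to x0, the triangle inequality
    and minimality give tau s <= 3 dist0 s for the cost tau s from the start to
    s; with dist0 >= m, this bounds delta by a nonincreasing function H of the
    cost, whose samples at the multiples of 3 are the terms summed by S. *)
Lemma geodesic_ray_length sig L : geodesic_path Om sig L -> slow sig L ->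
  (forall s, 0 <= s <= L -> dist0 sig 0 <= 2 * dist0 sig s) ->
  L <= 3 * (d0 * S).
Proof.
move=> [sigP geo] slow_sig near_min.
have [L0 _ _ _] := sigP.
pose tau u := fine (qh_cost Om sig 0 u).
have costE u v : 0 <= u -> u <= v -> v <= L ->
    qh_cost Om sig u v = (tau v - tau u)%:E.
  move=> u0 uv vL; have v0 := le_trans u0 uv.
  have fin0v := qh_cost_fin_num bdry oOm sigP (lexx 0) vL.
  have finuv := qh_cost_fin_num bdry oOm sigP u0 vL.
  have fin0u := qh_cost_fin_num bdry oOm sigP (lexx 0) (le_trans uv vL).
  move: (qh_cost_add bdry oOm sigP (lexx 0) u0 uv vL) fin0v finuv fin0u.
  rewrite /tau.
  case: (qh_cost _ _ 0 v) => // a; case: (qh_cost _ _ u v) => // b.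
  by case: (qh_cost _ _ 0 u) => // c [->] _ _ _ /=; rewrite addrAC subrr add0r.
have tau0 : tau 0 = 0 by rewrite /tau /qh_cost set_itv1 integral_set1.
have taum u v : 0 <= u -> u <= v -> v <= L -> tau u <= tau v.
  move=> u0 uv vL; rewrite -subr_ge0 -lee_fin -costE//.
  exact: (qh_cost_ge0 bdry oOm sigP).
have tau_dist u : 0 <= u <= L -> tau u <= 3 * dist0 sig u.
  move=> /[dup] u0L /andP[u0 uL].
  have [finu _ _] := slow_sig _ u0L.
  have [fin0 _ _] : [/\ qh_dist Om x0 (sig 0) \is a fin_num,
      m%:R <= dist0 sig 0 & delta Om (sig 0) <= d0 * h (dist0 sig 0)].
    by apply: slow_sig; rewrite lexx.
  have := le_trans (geo _ _ (lexx 0) u0 uL) (qh_dist_triangle bdry oOm x0 _ _).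
  rewrite (qh_dist_sym bdry oOm _ x0) costE// tau0 subr0.
  rewrite -(fineK fin0) -(fineK finu) -EFinD lee_fin => /le_trans; apply.
  by have := near_min _ u0L; rewrite /dist0; lra.
pose H t := d0 * h (Num.max m%:R (t / 3)).
have H_ge0 t : 0 <= t -> 0 <= H t by move=> _; rewrite mulr_ge0.
have Hni s t : 0 <= s -> s <= t -> H t <= H s.
  move=> _ st; rewrite ler_wpM2l// h_nonincreasing// ge_max le_max lexx/=.
  by rewrite le_max ler_pM2r ?st ?orbT// invr_gt0.
have delta_le_H u w : 0 <= u -> u <= w -> w <= L ->
    delta Om (sig w) <= H (tau u).
  move=> u0 uw wL; have w0L : 0 <= w <= L by rewrite (le_trans u0 uw).
  have [_ mw dw] := slow_sig _ w0L; apply: (le_trans dw).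
  rewrite ler_wpM2l// h_nonincreasing// ge_max mw/= ler_pdivrMr// mulrC.
  exact: le_trans (taum _ _ u0 uw wL) (tau_dist _ w0L).
have Hlen u v : 0 <= u -> u <= v -> v <= L ->
    v - u <= H (tau u) * (tau v - tau u).
  move=> u0 uv vL; have uL := le_trans uv vL.
  have Hpos : 0 < H (tau u).
    apply: lt_le_trans (delta_le_H u u u0 (lexx u) uL).
    by apply: (delta_path_gt0 bdry oOm sigP); rewrite u0.
  rewrite mulrC -ler_pdivrMr// -lee_fin -costE//.
  apply: (qh_cost_bound bdry oOm sigP) => // w /andP[uw wv].
  by apply: delta_le_H => //; exact: le_trans wv vL.
have tauL0 : 0 <= tau L by rewrite -tau0 taum.
have tauL_le : tau L <= 3 * (Num.bound (tau L))%:R.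
  apply: (@le_trans _ _ (Num.bound (tau L))%:R); first exact/ltW/archi_boundP.
  by rewrite ler_peMl// ler1n.
apply: le_trans (length_le_discrete_sum _ tau0 H_ge0 Hni taum Hlen
  L0 (lexx L) tauL_le) _ => //.
rewrite ler_pM2l// -mulr_sumr ler_wpM2l//.
apply: le_trans (h_sum (Num.bound (tau L))).
rewrite le_eqVlt; apply/orP; left; apply/eqP/eq_bigr => i _; congr h.
rewrite mulrC mulKf//; have [mi|im] := leqP m i.
  by rewrite max_r// ler_nat.
by rewrite max_l// ler_nat ltnW.
Qed.

(** The path is cut at a point almost closest to x0, and both halves are
    followed from there. *)
Lemma geodesic_length sig L : (0 < m)%N -> geodesic_path Om sig L ->
  slow sig L -> L <= 6 * (d0 * S).
Proof.
move=> m0 sigG slow_sig; have [[L0 _ _ _] _] := sigG.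
pose A := [set dist0 sig s | s in [set s | 0 <= s <= L]].
have m_lb : lbound A m%:R by move=> _ [s /slow_sig[_ ms _] <-].
have infA : has_inf A.
  by split; [exists (dist0 sig 0), 0; rewrite //= lexx|exists m%:R].
have m_gt0 : 0 < m%:R :> R by rewrite ltr0n.
have inf_gt0 : 0 < inf A by apply: lt_le_trans (lb_le_inf infA.1 m_lb).
have [_ [u /= uL <-] u_near] := inf_adherent inf_gt0 infA.
have near_min s : 0 <= s <= L -> dist0 sig u <= 2 * dist0 sig s.
  move=> sL; have : inf A <= dist0 sig s.
    by apply: ge_inf; [exact: infA.2|exists s].
  by move: u_near; lra.
have r1 := geodesic_ray_length (geodesic_path_sub sigG uL).
have r2 := geodesic_ray_length (geodesic_path_rev sigG uL).
have {}r1 : L - u <= 3 * (d0 * S).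
  apply: r1 => s sL; first by apply: slow_sig; move: sL uL; lra.
  by rewrite /dist0 add0r; apply: near_min; move: sL uL; lra.
have {}r2 : u <= 3 * (d0 * S).
  apply: r2 => s sL; first by apply: slow_sig; move: sL uL; lra.
  by rewrite /dist0 subr0; apply: near_min; move: sL uL; lra.
by lra.
Qed.

End geodesic_path.

(** * Visibility *)

Unset Implicit Arguments.

Theorem theorem2p5 (R : realType) (n : nat) (hn : (0 < n)%N)
    (Om : set 'rV[R]_n) (hOm : bounded_domain Om)
    (x0 : 'rV[R]_n) (hx0 : Om x0)
    (phi : R -> R)
    (phi_gt0 : forall t : R, 0 < t -> 0 < phi t)
    (phi_incr : forall s t : R, 0 < s -> s < t -> phi s < phi t)
    (phi_infty : phi t @[t --> +oo] --> +oo)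
    (phi_int : (\int[@lebesgue_measure R]_(t in `]0%R, +oo[)
                  (ginv phi t)^-1 < +oo)%E)
    (growth : forall x : 'rV[R]_n, Om x ->
       (qh_dist Om x0 x <= (phi (delta Om x0 / delta Om x))%:E)%E) :
  qh_visibility_domain Om.
Proof.
have [[_ oOm _] bndOm] := hOm; split=> // p q Bp Bq pq.
have bdry : euc_boundary Om !=set0 by exists p.
set d0 := delta Om x0 in growth.
have d0_gt0 : 0 < d0 by exact: delta_gt0.
pose c := enorm (p - q).
have c_gt0 : 0 < c.
  rewrite lt_neqAle enorm_ge0 andbT eq_sym; apply/eqP => /enorm_eq0 /eqP.
  by rewrite subr_eq0 => /eqP.
have c4_gt0 : 0 < c / 4 by rewrite divr_gt0.
have h_ge0 := decay_rate_ge0 phi.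
have h_ni := decay_rate_nonincreasing phi.
have [C hC] := decay_rate_summable phi_int.
(* chosen for 6 * d0 * e = c / 4, less than the distance c / 2 separating the
   neighborhoods below *)
pose e := c / (24 * d0).
have e_gt0 : 0 < e by rewrite divr_gt0// mulr_gt0.
have [m m_gt0 hm] : exists2 m, (0 < m)%N &
    forall N, \sum_(0 <= i < N) decay_rate phi (maxn m i)%:R <= e.
  apply: (truncated_sum_small (fun i => h_ge0 i%:R) _ hC e_gt0) => i j ij.
  by apply: h_ni; rewrite ler_nat.
(* below eps, ln (d0 / delta) and hence the distance to x0 exceed m *)
pose eps := d0 * expR (- m%:R).
have eps_gt0 : 0 < eps by rewrite mulr_gt0// expR_gt0.
pose K := [set x | Om x /\ eps <= delta Om x].
exists [set x | enorm (p - x) < c / 4], [set x | enorm (q - x) < c / 4], K.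
split; split.
- exact: nbhs_enorm_ball.
- exact: nbhs_enorm_ball.
- apply/seteqP; split=> // y [clU clV].
  have [u [/= pu yu]] := clU _ (nbhs_enorm_ball y c4_gt0).
  have [v [/= qv yv]] := clV _ (nbhs_enorm_ball y c4_gt0).
  have := ler_edistD u p q; have := ler_edistD y u q; have := ler_edistD v y q.
  by rewrite [enorm (u - y)]enorm_distC [enorm (v - q)]enorm_distC -/c; lra.
- have KOm : K `<=` Om by move=> x [].
  apply: bounded_closed_compact; last move=> y clK.
    case: bndOm => M [Mreal OmM]; exists M; split=> // r Mr x /KOm.
    exact: OmM.
  have eps_y : eps <= delta Om y.
    apply/ler_addgt0Pr => r r_gt0.
    have [x [[_ eps_x] /= yx]] := clK _ (nbhs_enorm_ball y r_gt0).
    have := delta_triangle bdry x y.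
    by rewrite [enorm (x - y)]enorm_distC; lra.
  split=> //; apply: (closure_delta_gt0 oOm); last exact: lt_le_trans eps_y.
  exact: closure_subset clK.
- by move=> x [].
- move=> gam T [gam_rect gam_geo] U0 VT; apply: contrapT => disj.
  have [T_ge0 _ gamOm _] := gam_rect.
  have [sig [L [sigP sig0 sigL sig_im costE]]] :=
    unit_speed_path_arclength gam_rect.
  have sigG : geodesic_path Om sig L.
    apply: (geodesic_path_of_endpoints bdry oOm sigP).
    rewrite sig0 sigL (gam_geo 0 T (lexx 0) T_ge0 (lexx T)) costE.
    exact: lexx.
  have slow s : 0 <= s <= L ->
      [/\ qh_dist Om x0 (sig s) \is a fin_num,
          m%:R <= fine (qh_dist Om x0 (sig s)) &
          delta Om (sig s) <=
            d0 * decay_rate phi (fine (qh_dist Om x0 (sig s)))].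
    move=> _; set x := sig s; have Omx : Om x by apply: gamOm; exact: sig_im.
    have dx_gt0 : 0 < delta Om x by exact: delta_gt0.
    have dx_eps : delta Om x < eps.
      rewrite ltNge; apply/negP => eps_x; apply: disj; exists x.
      by split; [exact: sig_im|split].
    have fin_x : qh_dist Om x0 x \is a fin_num.
      rewrite ge0_fin_numE; last exact: (qh_dist_ge0 bdry oOm).
      exact: le_lt_trans (growth _ Omx) (ltry _).
    have expm : expR m%:R <= d0 / delta Om x.
      rewrite (ler_pdivlMr _ _ dx_gt0) mulrC -(ler_pdivlMr _ _ (expR_gt0 _)).
      by rewrite -expRN; exact: (ltW dx_eps).
    have ratio_ge1 : 1 <= d0 / delta Om x.
      by apply: le_trans expm; rewrite -expR0 ler_expR.
    split; [exact: fin_x| |].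
    + rewrite -lee_fin (fineK fin_x).
      apply: le_trans (ln_le_qh_dist bdry oOm hx0 Omx).
      rewrite lee_fin -[leLHS]expRK ler_ln ?posrE; first exact: expm.
        exact: expR_gt0.
      exact: lt_le_trans ratio_ge1.
    + rewrite mulrC -(ler_pdivrMr _ _ d0_gt0) -invf_div.
      apply: (inv_le_decay_rate ratio_ge1).
      by rewrite -lee_fin (fineK fin_x); exact: growth.
  have := geodesic_length bdry oOm h_ge0 h_ni hm (ltW d0_gt0) m_gt0 sigG slow.
  have -> : 6 * (d0 * e) = c / 4.
    by rewrite /e; field; rewrite gt_eqF.
  have [L_ge0 lip _ _] := sigP; have := lip 0 L.
  rewrite sub0r normrN (ger0_norm L_ge0) sig0 sigL.
  have := ler_edistD (gam 0) p q; have := ler_edistD (gam T) (gam 0) q.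
  by move: U0 VT; rewrite /= [enorm (q - _)]enorm_distC -/c; lra.
Qed.
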